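(* Let $\mathcal{M}$ be a proper non-trivial closed submodule of $H_d^2$. Then there exist $\xi\in\mathcal{M}$ and a Möbius transform $\varphi$ of the unit ball such that $U_\varphi\xi\notin\mathcal{M}$.
   Context: $\mathcal{A}_d=\mathbb{C}[z_1,\dots,z_d]$, and $B_d$ is the open unit ball of $\mathbb{C}^d$. $H_d^2$ is the Hilbert space of holomorphic functions on $B_d$ with reproducing kernel $k(z,\lambda)=\frac{1}{1-\langle z,\lambda\rangle}$, and $k_\lambda=k(\cdot,\lambda)$; it is an $\mathcal{A}_d$-module with polynomials acting by multiplication, and submodules are taken with respect to this action (non-trivial means nonzero). A Möbius transform is a continuous bijection $\varphi:\overline{B_d}\to\overline{B_d}$ that is holomorphic in $B_d$ and satisfies $\varphi(B_d)=B_d$, $\varphi(\partial B_d)=\partial B_d$. For a Möbius transform $\varphi$ with $\lambda=\varphi^{-1}(0)$, $U_\varphi$ is the unitary operator on the Hilbert space $H_d^2$ given by $U_\varphi\xi=(\xi\circ\varphi)\frac{k_\lambda}{\|k_\lambda\|}$. *)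

(* Defs.v *)
From HB Require Import structures.
From mathcomp Require Import all_boot all_order all_algebra.
From mathcomp Require Import complex.
From mathcomp Require mpoly.
From mathcomp Require Import all_classical all_reals all_analysis.

Set Implicit Arguments.
Unset Strict Implicit.
Unset Printing Implicit Defensive.

Import Order.TTheory GRing.Theory Num.Theory.
Import numFieldNormedType.Exports.

Local Open Scope classical_set_scope.
Local Open Scope ring_scope.

(* The field R[i] only carries its norm topology under the alias R[i]^o. *)
Notation Cplx R := ((complex R)^o).

Section FunctionHilbertSpaces.
Variable R : realType.
Local Notation C := (Cplx R).

(* A Hilbert space whose vectors are functions T -> C, with inner product
   linear in the first argument; fh_dot is meaningful only on fh_carrier. *)
Record function_hilbert (T : Type) := FunctionHilbert {
  fh_carrier :> set (T -> C);
  fh_dot : (T -> C) -> (T -> C) -> C;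
  fh_zero : fh_carrier 0;
  fh_linear : forall (a : C) f g,
    fh_carrier f -> fh_carrier g -> fh_carrier (a *: f + g);
  fh_dot_linear : forall (a : C) f g h,
    fh_carrier f -> fh_carrier g -> fh_carrier h ->
    fh_dot (a *: f + g) h = a * fh_dot f h + fh_dot g h;
  fh_dot_conj : forall f g, fh_carrier f -> fh_carrier g ->
    fh_dot g f = Num.conj (fh_dot f g);
  fh_dot_gt0 : forall f, fh_carrier f -> f <> 0 -> 0 < fh_dot f f;
  fh_complete : forall u : nat -> T -> C, (forall n, fh_carrier (u n)) ->
    (forall e : C, 0 < e -> exists N, forall m n, (N <= m)%N -> (N <= n)%N ->
       sqrtC (fh_dot (u m - u n) (u m - u n)) < e) ->
    exists2 f, fh_carrier f &
      sqrtC (fh_dot (u n - f) (u n - f)) @[n --> \oo] --> (0 : C)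
}.

Definition fh_norm (T : Type) (H : function_hilbert T) (f : T -> C) : C :=
  sqrtC (fh_dot H f f).

Definition fh_closed (T : Type) (H : function_hilbert T) (M : set (T -> C)) :=
  forall (u : nat -> T -> C) (f : T -> C), (forall n, M (u n)) -> fh_carrier H f ->
    fh_norm H (u n - f) @[n --> \oo] --> (0 : C) -> M f.

Definition reproducing_kernel (T : Type) (H : function_hilbert T)
    (k : T -> T -> C) : Prop :=
  forall l : T, fh_carrier H (k^~ l) /\
    forall f, fh_carrier H f -> fh_dot H f (k^~ l) = f l.

End FunctionHilbertSpaces.

Section UnitBall.
Variables (R : realType) (d : nat).
Local Notation C := (Cplx R).

Definition cdot (z w : 'rV[C]_d) : C := \sum_(i < d) z 0 i * Num.conj (w 0 i).

(* The sets below are Euclidean, whereas `|z| on 'rV[C]_d is the sup norm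
   (which induces the same topology). *)
Definition uball : set 'rV[C]_d := [set z | cdot z z < 1].
Definition usphere : set 'rV[C]_d := [set z | cdot z z = 1].
Definition cball : set 'rV[C]_d := [set z | cdot z z <= 1].

Definition ball_pt := {z : 'rV[C]_d | cdot z z < 1}.

Lemma cdot00_lt1 : cdot 0 0 < 1.
Proof. by rewrite /cdot big1 ?ltr01 // => i _; rewrite mxE mul0r. Qed.

Definition ball0 : ball_pt := exist _ 0 cdot00_lt1.

Definition ball_ext (f : ball_pt -> C) (z : 'rV[C]_d) : C := oapp f 0 (insub z).

(* Holomorphy is Frechet differentiability over the field C; the ball being
   open, the extension by zero does not matter. *)
Definition holomorphic_on_ball (f : ball_pt -> C) : Prop :=
  forall z : ball_pt, differentiable (ball_ext f) (val z).

Definition da_kernel (z l : ball_pt) : C := (1 - cdot (val z) (val l))^-1.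

(* H^2_d, characterised up to the (unique) isometry that is the identity on
   functions. *)
Record drury_arveson := DruryArveson {
  da_space :> function_hilbert R ball_pt;
  da_holomorphic : forall f, fh_carrier da_space f -> holomorphic_on_ball f;
  da_reproducing : reproducing_kernel da_space da_kernel
}.

(* The values of the underlying function outside the closed ball are junk. *)
Record moebius := Moebius {
  mb_fun :> 'rV[C]_d -> 'rV[C]_d;
  mb_continuous : {within cball, continuous mb_fun};
  mb_bij : set_bij cball cball mb_fun;
  mb_holomorphic : forall z, uball z -> differentiable mb_fun z;
  mb_ball : mb_fun @` uball = uball;
  mb_sphere : mb_fun @` usphere = usphere
}.

(* By mb_ball the default value of insubd is never used. *)
Definition mb_ball_map (phi : moebius) (z : ball_pt) : ball_pt :=
  insubd ball0 (phi (val z)).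

(* phi^-1(0): by mb_ball and mb_bij there is exactly one such point. *)
Definition mb_inv0 (phi : moebius) : ball_pt :=
  xget ball0 [set l : ball_pt | phi (val l) = 0].

Definition U_moebius (H : drury_arveson) (phi : moebius) (xi : ball_pt -> C)
    (z : ball_pt) : C :=
  let k := da_kernel^~ (mb_inv0 phi) in
  xi (mb_ball_map phi z) * (k z / fh_norm H k).

Record closed_submodule (H : drury_arveson) (M : set (ball_pt -> C)) : Prop :=
  ClosedSubmodule {
    csm_sub : M `<=` H;
    csm_zero : M 0;
    csm_add : forall f g, M f -> M g -> M (f + g);
    csm_poly : forall (p : mpoly.mpoly d C) f, M f ->
      M (fun z => mpoly.meval (fun i => val z 0 i) p * f z);
    csm_closed : fh_closed H M
  }.

End UnitBall.

(* Main.v *)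
Require Import Defs.
From mathcomp Require Import all_boot all_order all_algebra.
From mathcomp Require Import complex.
From mathcomp Require mpoly.
From mathcomp Require Import all_classical all_reals all_analysis.
From mathcomp Require Import ring.

Set Implicit Arguments.
Unset Strict Implicit.
Unset Printing Implicit Defensive.

Import Order.TTheory GRing.Theory Num.Theory.
Import numFieldNormedType.Exports.

Local Open Scope classical_set_scope.
Local Open Scope ring_scope.

(** Suppose that [M] is a nonzero closed submodule stable under every
    [U_moebius H phi]; then [M] is the whole space, because the operators
    [U_moebius H phi] act irreducibly.  The argument follows the vector [p], the
    orthogonal projection of the constant function [1 = k_0] on [M]; it is the
    element of [M] that represents evaluation at the origin, [<g, p> = g 0] for
    [g] in [M] (lemma [fh_projection]).

    - [p] is invariant under the rotations [z |-> a z] with [|a| = 1].  Rotations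
      are Moebius transforms fixing [0], so they preserve [M] and evaluation at
      [0]; they also preserve the kernel, hence composition with them is unitary
      (lemma [fh_comp_dot]), and uniqueness of the representing vector applies
      (lemma [origin_representer_rotation]).

    - A rotation invariant [p] in the space is constant
      (lemma [rotation_invariant_const]).  Averaging [p z = <p, k_z>] over the
      rotations by the [2^n]-th roots of unity gives [p z = <p, K_n(., z)>] with
      [K_n(w, z) = 1 / (1 - <w, z>^(2^n))], and these averaged kernels tend to
      [1 = k_0] in norm.

    - [p] is nonzero.  Choose [f] in [M] and [l] in the ball with [f l <> 0], and
      the involution [phi_l] of the ball exchanging [0] and [l].  Then
      [U f] lies in [M] and does not vanish at [0], whereas [<U f, p> = (U f) 0].

    So [M] contains the constants.  Applying the operators of the [phi_l] again,
    now to [1], produces all the kernel functions [k_l] up to scalars, and those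
    span a dense subspace (lemma [kernel_span_dense]). *)

(** * Hilbert spaces of functions *)

(** The scalar core of every Cauchy-Schwarz inequality below: [a], [b], [c] stand
    for [<f,f>], [<g,g>], [<f,g>], and the hypothesis says that [<f+tg, f+tg>]
    stays nonnegative.  It is kept separate from any form so that [a] can also be
    the excess of a squared distance over a lower bound, as in
    [fh_near_minimizer]. *)
Lemma hermitian_form_discriminant (K : numClosedFieldType) (a b c : K) :
  0 <= b ->
  (forall t : K, 0 <= a + t * Num.conj c + Num.conj t * c + t * Num.conj t * b) ->
  `|c| ^+ 2 <= a * b.
Proof.
move=> b0 h; rewrite normCK.
have a0 : 0 <= a by have := h 0; rewrite conjC0 !mul0r !addr0.
have rK (x : K) : 0 <= x -> Num.conj x = x by move=> x0; rewrite conj_Creal ?ger0_real.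
set n := c * Num.conj c; have n0 : 0 <= n by rewrite /n -normCK exprn_ge0.
have key (x : K) : 0 <= x -> 0 <= a - 2 * x * n + x ^+ 2 * n * b.
  move=> x0; have := h (- x * c).
  have -> : Num.conj (- x * c) = - x * Num.conj c by rewrite rmorphM rmorphN /= rK.
  by congr (0 <= _); rewrite /n; ring.
have [n_eq0|nn0] := eqVneq n 0; first by rewrite n_eq0 mulr_ge0.
(* For [b = 0] the form is affine in [t]; this multiple of [- c] makes it negative. *)
have [b_eq0|bn0] := eqVneq b 0.
  have := key ((a + 1) / n) (divr_ge0 (addr_ge0 a0 ler01) n0).
  have -> : a - 2 * ((a + 1) / n) * n + ((a + 1) / n) ^+ 2 * n * b = - (a + 2).
    by rewrite b_eq0; field.
  rewrite oppr_ge0 => a2; have : 0 < a + 2 by rewrite ltr_wpDl.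
  by move=> /lt_le_trans /(_ a2); rewrite ltxx.
have := key b^-1; rewrite invr_ge0 => /(_ b0).
have -> : a - 2 * b^-1 * n + b^-1 ^+ 2 * n * b = (a * b - n) / b by field.
by rewrite pmulr_lge0 ?subr_ge0 // invr_gt0 lt_def bn0.
Qed.

Lemma complex_inv_succ_lt (R : realType) (e : R[i]) : 0 < e ->
  exists N, forall n, (N <= n)%N -> n.+1%:R^-1 < e.
Proof.
move=> e0; have eE : e = (complex.Re e)%:C%C by rewrite RRe_real // gtr0_real.
move: e0; rewrite eE -[0]/(0%:C%C) ltcR => e0.
have [N] := ltr_add_invr e0; rewrite add0r => N_lt; exists N => n Nn.
rewrite -(@rmorph_nat _ _ (real_complex R)) -fmorphV ltcR (le_lt_trans _ N_lt) //.
by rewrite lef_pV2 ?posrE ?ltr0n // ler_nat.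
Qed.

Lemma expr_pow2_lt (R : realType) (a e : R[i]) : 0 <= a -> a < 1 -> 0 < e ->
  exists n, a ^+ (2 ^ n) < e.
Proof.
move=> a0 a1 e0.
have aE : a = (complex.Re a)%:C%C by rewrite RRe_real // ger0_real.
have eE : e = (complex.Re e)%:C%C by rewrite RRe_real // gtr0_real.
move: a0 a1 e0; rewrite aE eE -[0]/(0%:C%C) -[1]/(1%:C%C) lecR !ltcR.
move: (complex.Re a) (complex.Re e) => r t r0 r1 t0.
have := @cvg_expr _ r; rewrite ger0_norm // => /(_ r1) /cvgrPdist_lt /(_ _ t0).
move=> [N _ N_lt]; exists N.
have := N_lt (2 ^ N)%N (ltnW (ltn_expl _ _)).
rewrite /= sub0r normrN ger0_norm ?exprn_ge0 // => /(_ isT).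
by rewrite -ltcR rmorphXn.
Qed.

Section FunctionHilbertSpaceTheory.
Variables (R : realType) (T : Type).
Local Notation C := (Cplx R).
Variable H : function_hilbert R T.
Implicit Types f g h : T -> C.

Lemma fh_scale (a : C) f : fh_carrier H f -> fh_carrier H (a *: f).
Proof. by move=> Hf; rewrite -[_ *: _]addr0; apply: fh_linear (fh_zero H). Qed.

Lemma fh_add f g : fh_carrier H f -> fh_carrier H g -> fh_carrier H (f + g).
Proof. by move=> Hf Hg; rewrite -[f]scale1r; apply: fh_linear. Qed.

Lemma fh_sub f g : fh_carrier H f -> fh_carrier H g -> fh_carrier H (f - g).
Proof. by move=> Hf Hg; rewrite addrC -scaleN1r; apply: fh_linear. Qed.

Lemma fh_dotDl f g h : fh_carrier H f -> fh_carrier H g -> fh_carrier H h ->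
  fh_dot H (f + g) h = fh_dot H f h + fh_dot H g h.
Proof. by move=> Hf Hg Hh; rewrite -[f]scale1r fh_dot_linear // mul1r scale1r. Qed.

Lemma fh_dot0l h : fh_carrier H h -> fh_dot H 0 h = 0.
Proof.
move=> Hh; have := fh_dotDl (fh_zero H) (fh_zero H) Hh.
by rewrite addr0 => /eqP; rewrite -subr_eq subrr eq_sym => /eqP.
Qed.

Lemma fh_dotZl (a : C) f h : fh_carrier H f -> fh_carrier H h ->
  fh_dot H (a *: f) h = a * fh_dot H f h.
Proof.
move=> Hf Hh; rewrite -[a *: f]addr0 fh_dot_linear ?fh_dot0l ?addr0 //.
exact: fh_zero.
Qed.

Lemma fh_dotBl f g h : fh_carrier H f -> fh_carrier H g -> fh_carrier H h ->
  fh_dot H (f - g) h = fh_dot H f h - fh_dot H g h.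
Proof.
by move=> Hf Hg Hh; rewrite addrC -scaleN1r fh_dot_linear // mulN1r addrC.
Qed.

Lemma fh_dotDr f g h : fh_carrier H f -> fh_carrier H g -> fh_carrier H h ->
  fh_dot H h (f + g) = fh_dot H h f + fh_dot H h g.
Proof.
move=> Hf Hg Hh; rewrite (fh_dot_conj (fh_add Hf Hg) Hh) fh_dotDl // rmorphD /=.
by rewrite (fh_dot_conj Hf Hh) (fh_dot_conj Hg Hh).
Qed.

Lemma fh_dotZr (a : C) f h : fh_carrier H f -> fh_carrier H h ->
  fh_dot H h (a *: f) = Num.conj a * fh_dot H h f.
Proof.
move=> Hf Hh; rewrite (fh_dot_conj (fh_scale a Hf) Hh) fh_dotZl // rmorphM /=.
by rewrite (fh_dot_conj Hf Hh).
Qed.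

Lemma fh_dotBr f g h : fh_carrier H f -> fh_carrier H g -> fh_carrier H h ->
  fh_dot H h (f - g) = fh_dot H h f - fh_dot H h g.
Proof.
move=> Hf Hg Hh; rewrite (fh_dot_conj (fh_sub Hf Hg) Hh) fh_dotBl // rmorphB /=.
by rewrite (fh_dot_conj Hf Hh) (fh_dot_conj Hg Hh).
Qed.

Lemma fh_dot_ge0 f : fh_carrier H f -> 0 <= fh_dot H f f.
Proof.
move=> Hf; have [->|/eqP fn0] := eqVneq f 0; first by rewrite (fh_dot0l (fh_zero H)).
exact/ltW/fh_dot_gt0.
Qed.

Lemma fh_norm_ge0 f : fh_carrier H f -> 0 <= fh_norm H f.
Proof. by move=> Hf; rewrite /fh_norm sqrtC_ge0 fh_dot_ge0. Qed.

Lemma fh_norm_sqr f : fh_norm H f ^+ 2 = fh_dot H f f.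
Proof. exact: sqrtCK. Qed.

Lemma fh_norm_eq0 f : fh_carrier H f -> fh_norm H f = 0 -> f = 0.
Proof.
move=> Hf nf0; have [//|/eqP fn0] := eqVneq f 0.
by have := fh_dot_gt0 Hf fn0; rewrite -fh_norm_sqr nf0 expr0n ltxx.
Qed.

Lemma fh_cauchy_schwarz f g : fh_carrier H f -> fh_carrier H g ->
  `|fh_dot H f g| <= fh_norm H f * fh_norm H g.
Proof.
move=> Hf Hg; rewrite -(@ler_pXn2r _ 2) ?nnegrE ?mulr_ge0 ?fh_norm_ge0 //.
rewrite exprMn !fh_norm_sqr; apply: hermitian_form_discriminant.
  exact: fh_dot_ge0.
move=> t; have Htg := fh_scale t Hg; have Hs := fh_add Hf Htg.
have := fh_dot_ge0 Hs.
rewrite fh_dotDl // !fh_dotDr // !fh_dotZl // !fh_dotZr // (fh_dot_conj Hf Hg).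
by congr (0 <= _); ring.
Qed.

Definition fh_cvg (u : nat -> T -> C) f : Prop :=
  fh_norm H (u n - f) @[n --> \oo] --> (0 : C).

Lemma fh_dot_cvg u f g : (forall n, fh_carrier H (u n)) ->
  fh_carrier H f -> fh_carrier H g -> fh_cvg u f ->
  fh_dot H (u n) g @[n --> \oo] --> (fh_dot H f g : C).
Proof.
move=> Hu Hf Hg uf; apply/cvgrPdist_lt => e e0.
have e'0 : 0 < e / (fh_norm H g + 1).
  by rewrite divr_gt0 // ltr_wpDl ?fh_norm_ge0.
move/cvgrPdist_lt : uf => /(_ _ e'0); apply: filterS => n.
have Huf := fh_sub (Hu n) Hf.
rewrite sub0r normrN ger0_norm ?fh_norm_ge0 // ltr_pdivlMr ?ltr_wpDl ?fh_norm_ge0 //.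
rewrite distrC -fh_dotBl // => /le_lt_trans; apply.
rewrite (le_trans (fh_cauchy_schwarz Huf Hg)) // ler_wpM2l ?fh_norm_ge0 //.
by rewrite lerDl.
Qed.

(** If [u] in [V] almost minimises the distance to [f], then [f - u] is almost
    orthogonal to [V]: the discriminant bound applied to the excess of
    [|f - u + t v|^2] over the lower bound [m].  Orthogonality of the limit and the Cauchy
    property of minimising sequences both follow from this estimate. *)
Lemma fh_near_minimizer (V : set (T -> C)) f u (m r : C) :
    V `<=` fh_carrier H ->
    (forall (a : C) v w, V v -> V w -> V (a *: v + w)) ->
    fh_carrier H f -> V u -> 0 <= r ->
    (forall v, V v -> m <= fh_dot H (f - v) (f - v)) ->
    fh_dot H (f - u) (f - u) <= m + r ^+ 2 ->
  forall v, V v -> `|fh_dot H (f - u) v| <= r * fh_norm H v.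
Proof.
move=> VH Vlin Hf Vu r0 m_le u_le v Vv.
have [Hu Hv] := (VH _ Vu, VH _ Vv); have Hfu := fh_sub Hf Hu.
rewrite -(@ler_pXn2r _ 2) ?nnegrE ?mulr_ge0 ?fh_norm_ge0 //.
have fv0 := fh_dot_ge0 Hv.
rewrite exprMn fh_norm_sqr
  (@le_trans _ _ ((fh_dot H (f - u) (f - u) - m) * fh_dot H v v)) //;
  last by rewrite ler_wpM2r // lerBlDl.
apply: hermitian_form_discriminant => // t.
have Htv := fh_scale t Hv; have Hs := fh_add Hfu Htv.
have := m_le _ (Vlin (- t) _ _ Vv Vu).
have -> : f - (- t *: v + u) = f - u + t *: v by rewrite opprD scaleNr opprK addrAC addrA.
rewrite -subr_ge0; move: (f - u) Hfu Hs => g Hg Hs.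
rewrite fh_dotDl // !fh_dotDr // !fh_dotZl // !fh_dotZr // (fh_dot_conj Hg Hv).
by congr (0 <= _); ring.
Qed.

(** The orthogonal projection [p] of [f] on the closure of [V], together with a
    sequence in [V] that converges to it; [V] is an arbitrary subspace because the
    lemma is applied both to closed submodules and to spans of kernel functions. *)
Lemma fh_projection (V : set (T -> C)) f :
    V `<=` fh_carrier H -> V 0 ->
    (forall (a : C) v w, V v -> V w -> V (a *: v + w)) ->
    fh_carrier H f ->
  exists p u, [/\ fh_carrier H p, forall n, V (u n), fh_cvg u p
    & forall v, V v -> fh_dot H (f - p) v = 0].
Proof.
move=> VH V0 Vlin Hf.
pose sqn g : R := complex.Re (fh_dot H g g).
have sqnE g : fh_carrier H g -> fh_dot H g g = (sqn g)%:C%C.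
  by move=> /fh_dot_ge0/ger0_real/RRe_real.
have HB v : V v -> fh_carrier H (f - v) by move=> /VH; apply: fh_sub.
pose E := [set sqn (f - v) | v in V].
have E_lb : lbound E 0.
  move=> _ [v Vv <-]; rewrite -ler0c -sqnE; last exact: HB.
  exact/fh_dot_ge0/HB.
have E_inf : has_inf E by split; [exists (sqn (f - 0)); exists 0 | exists 0].
have u_ex n : exists v, V v /\ sqn (f - v) <= inf E + n.+1%:R^-1 ^+ 2.
  have [|_ [v Vv <-] v_lt] := @inf_adherent _ E (n.+1%:R^-1 ^+ 2) _ E_inf.
    by rewrite exprn_gt0 // invr_gt0 ltr0n.
  by exists v; split=> //; exact: ltW.
have [u u_prop] := choice u_ex.
have Vu n : V (u n) by have [] := u_prop n.
have Hu n := VH _ (Vu n).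
have V_B v w : V v -> V w -> V (v - w).
  by move=> Vv Vw; rewrite addrC -scaleN1r; apply: Vlin.
have u_near n v : V v -> `|fh_dot H (f - u n) v| <= n.+1%:R^-1 * fh_norm H v.
  apply: (@fh_near_minimizer V f (u n) (inf E)%:C%C) => //.
  - move=> w Vw; rewrite sqnE ?lecR; last exact: HB.
    by apply: ge_inf; [exists 0 | exists w].
  - rewrite sqnE; last exact: HB.
    have [_] := u_prop n; rewrite -lecR => /le_trans; apply.
    by rewrite rmorphD rmorphXn fmorphV rmorph_nat.
have u_diff m n : fh_norm H (u m - u n) <= m.+1%:R^-1 + n.+1%:R^-1.
  have Vmn := V_B _ _ (Vu m) (Vu n); have Hmn := VH _ Vmn.
  have [->|nz] := eqVneq (fh_norm H (u m - u n)) 0; first by rewrite addr_ge0.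
  rewrite -(@ler_pM2r _ (fh_norm H (u m - u n))); last first.
    by rewrite lt_def nz fh_norm_ge0.
  rewrite -expr2 fh_norm_sqr.
  (* Two almost minimisers are close to each other since [f - u m] and [f - u n]
     are both almost orthogonal to their difference. *)
  have dotE : fh_dot H (u m - u n) (u m - u n) =
      fh_dot H (f - u n) (u m - u n) - fh_dot H (f - u m) (u m - u n).
    rewrite -fh_dotBl //; [|exact: fh_sub|exact: fh_sub].
    by rewrite opprB [f - _ + _]addrC subrKA.
  rewrite -(ger0_norm (fh_dot_ge0 Hmn)) dotE (le_trans (ler_normB _ _)) //.
  by rewrite mulrDl [leRHS]addrC lerD // u_near.
have [e e0|p Hp up] := fh_complete Hu.
  have e2 : 0 < e / 2 by rewrite divr_gt0.
  have [N N_lt] := complex_inv_succ_lt e2.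
  exists N => m n Nm Nn; rewrite (le_lt_trans (u_diff m n)) // [e]splitr.
  by rewrite ltrD // N_lt.
exists p, u; split=> // v Vv; have Hv := VH _ Vv.
have dot_p : fh_dot H (f - u n) v @[n --> \oo] --> (fh_dot H (f - p) v : C).
  rewrite fh_dotBl //; under eq_cvg => n do rewrite fh_dotBl //.
  by apply: cvgB; [exact: cvg_cst|exact: fh_dot_cvg].
have dot_0 : fh_dot H (f - u n) v @[n --> \oo] --> (0 : C).
  apply/cvgrPdist_lt => e e0.
  have e'0 : 0 < e / (fh_norm H v + 1) by rewrite divr_gt0 // ltr_wpDl ?fh_norm_ge0.
  have [N N_lt] := complex_inv_succ_lt e'0.
  exists N => // n /= Nn; rewrite sub0r normrN (le_lt_trans (u_near _ _ Vv)) //.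
  have := N_lt n Nn; rewrite ltr_pdivlMr ?ltr_wpDl ?fh_norm_ge0 //.
  apply: le_lt_trans; rewrite ler_wpM2l // lerDl //.
exact: cvg_unique dot_p dot_0.
Qed.

Lemma fh_ler_normD f g : fh_carrier H f -> fh_carrier H g ->
  fh_norm H (f + g) <= fh_norm H f + fh_norm H g.
Proof.
move=> Hf Hg; have Hs := fh_add Hf Hg.
have [->|nz] := eqVneq (fh_norm H (f + g)) 0; first by rewrite addr_ge0 ?fh_norm_ge0.
rewrite -(@ler_pM2r _ (fh_norm H (f + g))); last by rewrite lt_def nz fh_norm_ge0.
rewrite -expr2 fh_norm_sqr -(ger0_norm (fh_dot_ge0 Hs)) {1}fh_dotDl // mulrDl.
by rewrite (le_trans (ler_normD _ _)) // lerD // fh_cauchy_schwarz.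
Qed.

Lemma fh_normBC f g : fh_carrier H f -> fh_carrier H g ->
  fh_norm H (f - g) = fh_norm H (g - f).
Proof.
move=> Hf Hg; rewrite /fh_norm; congr sqrtC.
by rewrite !fh_dotBl ?fh_dotBr //; [ring|exact: fh_sub..].
Qed.

Inductive kernel_span (k : T -> T -> C) : (T -> C) -> Prop :=
| kernel_span0 : kernel_span k 0
| kernel_span_cons a l f : kernel_span k f -> kernel_span k (a *: k^~ l + f).

Lemma kernel_span_linear (k : T -> T -> C) (a : C) f g :
  kernel_span k f -> kernel_span k g -> kernel_span k (a *: f + g).
Proof.
move=> kf kg; elim: kf => [|b l h _ IH]; first by rewrite scaler0 add0r.
by rewrite scalerDr scalerA -addrA; apply: kernel_span_cons.
Qed.

Section Kernel.
Variable k : T -> T -> C.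
Hypothesis kP : reproducing_kernel H k.

Lemma kernel_carrier l : fh_carrier H (k^~ l).
Proof. by have [] := kP l. Qed.

Lemma kernel_dot l f : fh_carrier H f -> fh_dot H f (k^~ l) = f l.
Proof. by have [_] := kP l; apply. Qed.

Lemma kernel_span_sub : kernel_span k `<=` fh_carrier H.
Proof.
move=> f; elim=> [|a l g _ Hg]; first exact: fh_zero.
exact: fh_linear (kernel_carrier l) Hg.
Qed.

(** A vector orthogonal to all the kernel functions vanishes pointwise. *)
Lemma kernel_span_dense f : fh_carrier H f ->
  exists2 u, forall n, kernel_span k (u n) & fh_cvg u f.
Proof.
move=> Hf; have [p [u [Hp ku up p_orth]]] :=
  fh_projection kernel_span_sub (kernel_span0 k) (@kernel_span_linear k) Hf.
exists u => //; suff -> : f = p by [].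
apply/funext => l; apply/eqP; rewrite -subr_eq0; apply/eqP.
have kl : kernel_span k (k^~ l).
  rewrite -[k^~ l]addr0 -[k^~ l]scale1r.
  by apply: kernel_span_cons; exact: kernel_span0.
by have := p_orth _ kl; rewrite kernel_dot //; exact: fh_sub.
Qed.

Lemma fh_cvg_pointwise u f l : (forall n, fh_carrier H (u n)) -> fh_carrier H f ->
  fh_cvg u f -> u n l @[n --> \oo] --> (f l : C).
Proof.
move=> Hu Hf uf; rewrite -(kernel_dot l Hf).
under eq_cvg => n do rewrite -(kernel_dot l (Hu n)).
exact: fh_dot_cvg (kernel_carrier l) uf.
Qed.

(** A symmetry [tau] of the kernel permutes the kernel functions, hence acts
    isometrically on their span and, by density, unitarily on the whole space. *)
Section KernelSymmetry.
Variables (tau sigma : T -> T).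
Hypothesis sigmaK : cancel sigma tau.
Hypothesis tau_kernel : forall x y, k (tau x) (tau y) = k x y.

Let kernel_comp l : (k^~ l) \o tau = k^~ (sigma l).
Proof. by apply/funext => x /=; rewrite -{1}[l]sigmaK tau_kernel. Qed.

Let kernel_span_comp f : kernel_span k f -> kernel_span k (f \o tau).
Proof.
elim=> [|a l g _ IH]; first exact: kernel_span0.
have -> : (a *: k^~ l + g) \o tau = a *: ((k^~ l) \o tau) + (g \o tau) by [].
by rewrite kernel_comp; apply: kernel_span_cons.
Qed.

Let span_dot_comp f g : kernel_span k f -> fh_carrier H g ->
  fh_carrier H (g \o tau) -> fh_dot H (f \o tau) (g \o tau) = fh_dot H f g.
Proof.
move=> kf Hg Hgt; elim: kf => [|a l h kh IH].
  by have -> : (0 : T -> C) \o tau = 0 by []; rewrite !fh_dot0l.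
have -> : (a *: k^~ l + h) \o tau = a *: ((k^~ l) \o tau) + (h \o tau) by [].
have Hkl := kernel_carrier l.
rewrite kernel_comp !fh_dot_linear ?IH //;
  do ?[exact: kernel_span_sub | exact: kernel_carrier].
  rewrite (fh_dot_conj Hgt (kernel_carrier _)) (fh_dot_conj Hg Hkl).
  by rewrite !kernel_dot //= sigmaK.
by apply: kernel_span_sub; exact: kernel_span_comp.
Qed.

(** Membership of [f \o tau] in the space is itself a conclusion: the images of
    kernel combinations approximating [f] form a Cauchy sequence, and pointwise
    convergence identifies the limit that completeness provides. *)
Let comp_limit f : fh_carrier H f -> exists u,
  [/\ forall n, kernel_span k (u n), fh_cvg u f, fh_carrier H (f \o tau)
    & fh_cvg (fun n => u n \o tau) (f \o tau)].
Proof.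
move=> Hf; have [u ku uf] := kernel_span_dense Hf; exists u.
have Hu n := kernel_span_sub (ku n).
have kut n := kernel_span_comp (ku n).
have Hut n := kernel_span_sub (kut n).
have [e e0|g Hg utg] := fh_complete Hut.
  have e2 : 0 < e / 2 by rewrite divr_gt0.
  move/cvgrPdist_lt : uf => /(_ _ e2) [N _ N_lt]; exists N => m n Nm Nn.
  have -> : (u m \o tau) - (u n \o tau) = (u m - u n) \o tau by [].
  have kmn : kernel_span k (u m - u n).
    by rewrite addrC -scaleN1r; apply: kernel_span_linear.
  rewrite span_dot_comp //; [|exact: kernel_span_sub|]; last first.
    by apply: kernel_span_sub; exact: kernel_span_comp.
  have := N_lt m Nm; have := N_lt n Nn.
  rewrite !sub0r !normrN !ger0_norm ?fh_norm_ge0 //; do ?exact: fh_sub.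
  move=> n_lt m_lt; rewrite -/(fh_norm H _) -(subrKA f).
  apply: (le_lt_trans (fh_ler_normD (fh_sub (Hu m) Hf) (fh_sub Hf (Hu n)))).
  by rewrite [e]splitr ltrD // fh_normBC.
suff gE : g = f \o tau by split=> //; rewrite -gE.
apply/funext => x; have ux_g := fh_cvg_pointwise (l := x) Hut Hg utg.
have ux_f := fh_cvg_pointwise (l := tau x) Hu Hf uf.
exact: cvg_unique ux_g ux_f.
Qed.

Lemma fh_comp_carrier f : fh_carrier H f -> fh_carrier H (f \o tau).
Proof. by move=> /comp_limit[u []]. Qed.

Lemma fh_comp_dot f g : fh_carrier H f -> fh_carrier H g ->
  fh_dot H (f \o tau) (g \o tau) = fh_dot H f g.
Proof.
move=> Hf Hg; have [u [ku uf Hft utf]] := comp_limit Hf.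
have Hgt := fh_comp_carrier Hg.
have Hu n := kernel_span_sub (ku n).
have Hut n := kernel_span_sub (kernel_span_comp (ku n)).
have ug := fh_dot_cvg Hu Hf Hg uf; have := fh_dot_cvg Hut Hft Hgt utf.
under eq_cvg => n do rewrite span_dot_comp //.
by move=> utg; exact: cvg_unique utg ug.
Qed.

End KernelSymmetry.
End Kernel.

End FunctionHilbertSpaceTheory.

(** * Automorphisms of the ball *)

Section Moebius.
Variables (R : realType) (d : nat).
Local Notation C := (Cplx R).
Local Notation V := 'rV[C]_d.
Implicit Types z w l : V.

Lemma cdotDl z w l : cdot (z + w) l = cdot z l + cdot w l.
Proof. by rewrite -big_split /=; apply: eq_bigr => i _; rewrite mxE mulrDl. Qed.

Lemma cdotZl (a : C) z l : cdot (a *: z) l = a * cdot z l.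
Proof. by rewrite mulr_sumr; apply: eq_bigr => i _; rewrite mxE mulrA. Qed.

Lemma cdotC z w : cdot w z = Num.conj (cdot z w).
Proof.
by rewrite rmorph_sum; apply: eq_bigr => i _; rewrite rmorphM /= conjCK mulrC.
Qed.

Lemma cdotDr z w l : cdot l (z + w) = cdot l z + cdot l w.
Proof. by rewrite cdotC cdotDl rmorphD /= -!cdotC. Qed.

Lemma cdotZr (a : C) z l : cdot l (a *: z) = Num.conj a * cdot l z.
Proof. by rewrite cdotC cdotZl rmorphM /= -cdotC. Qed.

Lemma cdot0l l : cdot 0 l = 0.
Proof. by rewrite -[0]/(0 : V) -(scale0r (0 : V)) cdotZl mul0r. Qed.

Lemma cdot0r l : cdot l 0 = 0.
Proof. by rewrite cdotC cdot0l conjC0. Qed.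

Lemma cdot_ge0 z : 0 <= cdot z z.
Proof. by apply: sumr_ge0 => i _; rewrite -normCK exprn_ge0. Qed.

Lemma cdot_cauchy_schwarz z w : `|cdot z w| ^+ 2 <= cdot z z * cdot w w.
Proof.
apply: hermitian_form_discriminant (cdot_ge0 w) _ => t.
have := cdot_ge0 (z + t *: w); rewrite cdotDl !cdotDr !cdotZl !cdotZr (cdotC z w).
by congr (0 <= _); ring.
Qed.

Lemma cdot_unit_scale (a : C) z w : `|a| = 1 -> cdot (a *: z) (a *: w) = cdot z w.
Proof.
by move=> a1; rewrite cdotZl cdotZr mulrA -normCK a1 expr1n mul1r.
Qed.

Lemma one_sub_cdot_neq0 z w : cdot z z <= 1 -> cdot w w < 1 -> 1 - cdot z w != 0.
Proof.
move=> z1 w1; rewrite subr_eq0; apply/negP => /eqP zw.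
have := cdot_cauchy_schwarz z w; rewrite -zw normr1 expr1n.
have zw1 : cdot z z * cdot w w < 1.
  by rewrite (le_lt_trans _ w1) // ler_piMl ?cdot_ge0.
by move=> /le_lt_trans /(_ zw1); rewrite ltxx.
Qed.

Lemma differentiable_cdotl w z : differentiable (fun x : V => cdot x w : C) z.
Proof.
rewrite (_ : (fun x => _) = \sum_(i < d) (fun x : V => Num.conj (w 0 i) *: (x 0 i : C))).
  apply: differentiable_sum => i; apply: differentiableZ.
  exact: differentiable_coord.
apply/funext => x; rewrite fct_sumE; apply: eq_bigr => i _.
by rewrite mulrC.
Qed.

(** Differentiability is checked on coordinates, where the rational map
    [ball_involution] is built from products and an inverse of scalar functions. *)
Lemma differentiable_row n (f : V -> 'rV[C]_n) z :
  (forall i, differentiable (fun x => f x 0 i : C) z) -> differentiable f z.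
Proof.
move=> df; rewrite (_ : f = \sum_(i < n) (fun x : V => f x 0 i *: delta_mx 0 i)).
  by apply: differentiable_sum => i; apply: differentiableZl.
by apply/funext => x; rewrite fct_sumE [LHS]row_sum_delta.
Qed.

(** The five conditions on a Moebius transform all follow from an inverse and the
    fact that both maps preserve the closed ball and, inside it, the open ball. *)
Section FromInverse.
Variables phi psi : V -> V.
Hypothesis phi_diff : forall z, cdot z z <= 1 -> differentiable phi z.
Hypothesis phi_ball : forall z, cdot z z <= 1 ->
  (cdot (phi z) (phi z) <= 1) * ((cdot (phi z) (phi z) < 1) = (cdot z z < 1)).
Hypothesis psi_ball : forall z, cdot z z <= 1 ->
  (cdot (psi z) (psi z) <= 1) * ((cdot (psi z) (psi z) < 1) = (cdot z z < 1)).
Hypothesis phiK : forall z, cdot z z <= 1 -> psi (phi z) = z.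
Hypothesis psiK : forall z, cdot z z <= 1 -> phi (psi z) = z.

Let phi_cball z : cdot z z <= 1 -> cdot (phi z) (phi z) <= 1.
Proof. by move=> /phi_ball ->. Qed.

Let psi_cball z : cdot z z <= 1 -> cdot (psi z) (psi z) <= 1.
Proof. by move=> /psi_ball ->. Qed.

Let from_inverse_continuous : {within @cball R d, continuous phi}.
Proof.
apply: continuous_in_subspaceT => z /set_mem z1.
exact/differentiable_continuous/phi_diff.
Qed.

Let from_inverse_holomorphic z : uball z -> differentiable phi z.
Proof. by move=> z1; apply: phi_diff; exact: ltW. Qed.

Let from_inverse_bij : set_bij (@cball R d) (@cball R d) phi.
Proof.
split.
- by move=> z; exact: phi_cball.
- by move=> z w /set_mem z1 /set_mem w1 zw; rewrite -(phiK z1) zw phiK.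
- by move=> z z1; exists (psi z); [exact: psi_cball|exact: psiK].
Qed.

Let from_inverse_ball : phi @` @uball R d = @uball R d.
Proof.
apply/seteqP; split=> [_ [z z1 <-]|z z1]; rewrite /uball /=.
  by rewrite phi_ball // ltW.
have z1' := ltW z1.
by exists (psi z); [rewrite /uball /= psi_ball | exact: psiK].
Qed.

Let from_inverse_sphere : phi @` @usphere R d = @usphere R d.
Proof.
have sphereE z : usphere z <-> cdot z z <= 1 /\ ~~ (cdot z z < 1).
  rewrite /usphere /= lt_neqAle; split=> [->|[z1]]; first by rewrite eqxx lexx.
  by rewrite z1 andbT negbK => /eqP.
apply/seteqP; split=> [_ [z /sphereE[z1 z2] <-]|z /sphereE[z1 z2]].
  by apply/sphereE; rewrite !phi_ball.
by exists (psi z); [apply/sphereE; rewrite !psi_ball | exact: psiK].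
Qed.

Definition moebius_of_inverse : moebius R d :=
  @Moebius R d phi from_inverse_continuous from_inverse_bij
    from_inverse_holomorphic from_inverse_ball from_inverse_sphere.

End FromInverse.

Section Rotation.
Variable a : C.
Hypothesis a1 : `|a| = 1.

Let conj_a1 : `|Num.conj a| = 1.
Proof. by rewrite norm_conjC. Qed.

Let rotation_diff z : cdot z z <= 1 -> differentiable (fun x : V => a *: x) z.
Proof. by move=> _; apply: differentiableZ; exact: ex_diff. Qed.

Let rotation_ball (b : C) z : `|b| = 1 -> cdot z z <= 1 ->
  (cdot (b *: z) (b *: z) <= 1) * ((cdot (b *: z) (b *: z) < 1) = (cdot z z < 1)).
Proof. by move=> b1 z1; rewrite cdot_unit_scale. Qed.

Let rotationK z : cdot z z <= 1 -> Num.conj a *: (a *: z) = z.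
Proof. by move=> _; rewrite scalerA mulrC -normCK a1 expr1n scale1r. Qed.

Let rotationVK z : cdot z z <= 1 -> a *: (Num.conj a *: z) = z.
Proof. by move=> _; rewrite scalerA -normCK a1 expr1n scale1r. Qed.

Definition moebius_rotation : moebius R d :=
  moebius_of_inverse rotation_diff (fun z => rotation_ball a1)
    (fun z => rotation_ball conj_a1) rotationK rotationVK.

Lemma moebius_rotationE z : moebius_rotation z = a *: z.
Proof. by []. Qed.

End Rotation.

Section Involution.
Variable l : V.
Hypothesis l1 : cdot l l < 1.

Let s : C := sqrtC (1 - cdot l l).

Let s0 : 0 < s.
Proof. by rewrite sqrtC_gt0 subr_gt0. Qed.

Let s_conj : Num.conj s = s.
Proof. by rewrite conj_Creal // gtr0_real. Qed.

Let c : C := (1 + s)^-1.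

Let c_conj : Num.conj c = c.
Proof. by rewrite fmorphV rmorphD /= conjC1 s_conj. Qed.

Let s1_neq0 : 1 + s != 0.
Proof. by rewrite gt_eqF // ltr_wpDl. Qed.

Let normlE : cdot l l = 1 - s ^+ 2.
Proof. by rewrite sqrtCK opprB addrC subrK. Qed.

(** The involutive automorphism of the ball exchanging [0] and [l], usually written
    [(l - P z - s Q z) / (1 - <z,l>)] with [P] the orthogonal projection on the
    line of [l], [Q = 1 - P] and [s = sqrt (1 - |l|^2)].  Here
    [P z + s Q z = s z + (1 - s) <z,l> / |l|^2 l], and [(1 - s) / |l|^2] is written
    as [c = 1 / (1 + s)], which covers [l = 0]. *)
Definition ball_involution (z : V) : V :=
  (1 - cdot z l)^-1 *: ((1 - c * cdot z l) *: l - s *: z).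

Lemma ball_involution_diff z : cdot z z <= 1 -> differentiable ball_involution z.
Proof.
move=> z1; have t1 := one_sub_cdot_neq0 z1 l1.
have dt := differentiable_cdotl l z.
have d1 : differentiable (fun x : V => 1 - cdot x l : C) z.
  exact: differentiableB (differentiable_cst _ _) dt.
apply: differentiable_row => i.
rewrite (_ : (fun x => _) = (fun x : V => (1 - cdot x l)^-1 : C) *
    ((fun x : V => l 0 i - (c * l 0 i) * cdot x l : C) - (fun x : V => s * x 0 i : C))).
  apply: differentiableM; first exact: differentiableV.
  apply: differentiableB.
    apply: differentiableB; first exact: differentiable_cst.
    exact: differentiableZ dt.
  apply: differentiableZ; exact: differentiable_coord.
by apply/funext => x; rewrite !mxE /= mulrBl mul1r mulrAC.
Qed.

(** The identity behind the invariance of the ball: the factor in front of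
    [1 - |z|^2] is positive, so the image of [z] lies inside, on or outside the
    sphere exactly as [z] does. *)
Lemma ball_involution_norm z : cdot z z <= 1 ->
  1 - cdot (ball_involution z) (ball_involution z) =
  s ^+ 2 * (1 - cdot z z) / `|1 - cdot z l| ^+ 2.
Proof.
move=> z1; have t1 := one_sub_cdot_neq0 z1 l1.
have t1' : 1 - Num.conj (cdot z l) != 0.
  by rewrite -conjC1 -rmorphB /= conjC_eq0.
rewrite normCK /ball_involution -(scaleNr s z).
rewrite !(cdotZl, cdotZr, cdotDl, cdotDr).
have conj1B x : Num.conj (1 - x) = 1 - Num.conj x :> C by rewrite rmorphB rmorph1.
rewrite fmorphV /= !conj1B.
have -> : Num.conj (- s) = - s by rewrite rmorphN /= s_conj.
have -> : Num.conj (c * cdot z l) = c * Num.conj (cdot z l).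
  by rewrite rmorphM /= c_conj.
rewrite normlE (cdotC z l).
move: (cdot z l) (Num.conj (cdot z l)) t1 t1' => t t' t1 t1'.
rewrite /c; field.
by rewrite t1 t1' s1_neq0.
Qed.

Lemma ball_involution_ball z : cdot z z <= 1 ->
  (cdot (ball_involution z) (ball_involution z) <= 1) *
  ((cdot (ball_involution z) (ball_involution z) < 1) = (cdot z z < 1)).
Proof.
move=> z1; have t1 := one_sub_cdot_neq0 z1 l1.
have k0 : 0 < s ^+ 2 / `|1 - cdot z l| ^+ 2.
  by rewrite divr_gt0 ?exprn_gt0 ?normr_gt0.
have E : 1 - cdot (ball_involution z) (ball_involution z) =
    s ^+ 2 / `|1 - cdot z l| ^+ 2 * (1 - cdot z z).
  by rewrite ball_involution_norm // mulrAC.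
split; first by rewrite -subr_ge0 E pmulr_rge0 // subr_ge0.
by rewrite -subr_gt0 E pmulr_rgt0 // subr_gt0.
Qed.

Lemma ball_involutionK z : cdot z z <= 1 -> ball_involution (ball_involution z) = z.
Proof.
move=> z1; have t1 := one_sub_cdot_neq0 z1 l1.
have tE : cdot (ball_involution z) l = (1 - s ^+ 2 - cdot z l) / (1 - cdot z l).
  rewrite /ball_involution -(scaleNr s z) cdotZl cdotDl !cdotZl normlE /c.
  by field; rewrite t1 s1_neq0.
have sn0 : s != 0 by rewrite gt_eqF.
rewrite {1}/ball_involution tE /ball_involution.
apply/rowP => i; rewrite !mxE /c; field.
rewrite s1_neq0 t1 /=.
have -> : 1 - cdot z l - (1 - s ^+ 2 - cdot z l) = s ^+ 2 by ring.
by rewrite expf_neq0.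
Qed.

Lemma ball_involution_center : ball_involution l = 0.
Proof.
rewrite /ball_involution -scalerBl normlE /c.
suff -> : 1 - (1 + s)^-1 * (1 - s ^+ 2) - s = 0 by rewrite scale0r scaler0.
by field.
Qed.

Lemma ball_involution0 : ball_involution 0 = l.
Proof. by rewrite /ball_involution cdot0l mulr0 subr0 invr1 !scale1r scaler0 subr0. Qed.

Definition moebius_involution : moebius R d :=
  moebius_of_inverse ball_involution_diff ball_involution_ball ball_involution_ball
    ball_involutionK ball_involutionK.

Lemma moebius_involutionE z : moebius_involution z = ball_involution z.
Proof. by []. Qed.

End Involution.

End Moebius.

(** * Irreducibility of the Moebius action *)

Section DruryArveson.
Variables (R : realType) (d : nat) (H : drury_arveson R d).
Local Notation C := (Cplx R).
Local Notation B := (ball_pt R d).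
Local Notation o := (@Defs.ball0 R d).
Local Notation k := (@da_kernel R d).
Implicit Types (z w l : B) (f g p : B -> C).

Lemma mb_ball_mapE (phi : moebius R d) z : val (mb_ball_map phi z) = phi (val z).
Proof.
rewrite val_insubd; suff -> : cdot (phi (val z)) (phi (val z)) < 1 by [].
have : (phi @` @uball R d) (phi (val z)) by exists (val z) => //; exact: (valP z).
by rewrite mb_ball.
Qed.

Lemma mb_inv0_unique (phi : moebius R d) l : phi (val l) = 0 -> mb_inv0 phi = l.
Proof.
move=> phil; rewrite /mb_inv0; case: xgetP => [w _ /= phiw|]; last by move=> /(_ l).
have in_cball z : val z \in @cball R d by rewrite inE; exact: ltW (valP z).
have [_ inj _] := mb_bij phi.
by apply: val_inj; apply: inj => //; rewrite phiw phil.
Qed.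

Lemma da_kernel_origin z : k z o = 1.
Proof. by rewrite /da_kernel cdot0r subr0 invr1. Qed.

Lemma fh_norm_kernel_sqr l : fh_norm H (k^~ l) ^+ 2 = k l l.
Proof.
have kP := da_reproducing H.
by rewrite fh_norm_sqr (kernel_dot kP) //; exact: (kernel_carrier kP).
Qed.

Lemma fh_norm_kernel_neq0 l : fh_norm H (k^~ l) != 0.
Proof.
rewrite -sqrf_eq0 fh_norm_kernel_sqr invr_eq0 subr_eq0 eq_sym.
by rewrite lt_eqF // (valP l).
Qed.

Lemma fh_norm_kernel_origin : fh_norm H (k^~ o) = 1.
Proof.
have H0 := fh_norm_ge0 (kernel_carrier (da_reproducing H) o).
by apply/eqP; rewrite -(sqrp_eq1 H0) fh_norm_kernel_sqr da_kernel_origin.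
Qed.

Lemma cdot_lt1 z w : `|cdot (val z) (val w)| < 1.
Proof.
rewrite -(@ltr_pXn2r _ 2) ?nnegrE // expr1n.
rewrite (le_lt_trans (cdot_cauchy_schwarz _ _)) //.
rewrite (le_lt_trans _ (valP w)) // ler_piMl ?cdot_ge0 //.
exact: ltW (valP z).
Qed.

Lemma U_moebius_rotation (a : C) (a1 : `|a| = 1) f :
  U_moebius H (moebius_rotation d a1) f = f \o mb_ball_map (moebius_rotation d a1).
Proof.
have inv0 : mb_inv0 (moebius_rotation d a1) = o.
  by apply: mb_inv0_unique; rewrite moebius_rotationE scaler0.
apply/funext => z; rewrite /U_moebius inv0 fh_norm_kernel_origin da_kernel_origin.
by rewrite /= divr1 mulr1.
Qed.

(** The mean of [k(., a w)] over the [2^n]-th roots of unity [a], in closed form. *)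
Definition rotation_average_kernel n (z w : B) : C :=
  (1 - cdot (val z) (val w) ^+ (2 ^ n))^-1.

(** Powers of two allow an induction on [n] in place of a sum over all roots of
    unity: with [a^(2^n) = -1], the identity
    [1/(1 - x^2) = (1/(1 - x) + 1/(1 + x)) / 2] expresses the next average at [l]
    by the current ones at [l] and [a l]. *)
Lemma rotation_average_kernelP n l :
  fh_carrier H ((rotation_average_kernel n)^~ l) /\
  forall f, fh_carrier H f ->
    (forall (a : C) z w, a ^+ (2 ^ n) = 1 -> val w = a *: val z -> f w = f z) ->
    fh_dot H f ((rotation_average_kernel n)^~ l) = f l.
Proof.
have kP := da_reproducing H.
elim: n l => [|n IH] l.
  have -> : (rotation_average_kernel 0)^~ l = k^~ l by [].
  split; first exact: (kernel_carrier kP).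
  by move=> f Hf _; exact: kernel_dot.
have N0 : (0 < 2 ^ n)%N by rewrite expn_gt0.
pose a : C := (2 ^ n).-root (-1).
have aN : a ^+ (2 ^ n) = -1 by rewrite rootCK.
have a1 : `|a| = 1.
  by apply/eqP; rewrite -(@pexpr_eq1 _ _ (2 ^ n)) // -normrX aN normrN normr1.
pose al := mb_ball_map (moebius_rotation d a1) l.
have alE : val al = a *: val l by rewrite mb_ball_mapE moebius_rotationE.
have [[Hl dl] [Hal dal]] := (IH l, IH al).
have -> : (rotation_average_kernel n.+1)^~ l =
    2^-1 *: ((rotation_average_kernel n)^~ l + (rotation_average_kernel n)^~ al).
  apply/funext => z; rewrite /= !fctE /rotation_average_kernel alE cdotZr exprMn.
  have -> : Num.conj a ^+ (2 ^ n) = -1 by rewrite -rmorphXn /= aN rmorphN rmorph1.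
  rewrite expnS mulnC exprM; set x := _ ^+ (2 ^ n).
  have x1 : `|x| < 1 by rewrite normrX exprn_ilt1 ?cdot_lt1 // -lt0n.
  have x1' : 1 - x != 0.
    by apply: contraTneq x1 => /subr0_eq <-; rewrite normr1 ltxx.
  have x1'' : 1 + x != 0.
    apply: contraTneq x1 => /eqP; rewrite addrC addr_eq0 => /eqP ->.
    by rewrite normrN normr1 ltxx.
  rewrite -[_ *: _]/(_ * _) mulN1r opprK -[1 - x ^+ 2]/(1 - x ^+ 2).
  have -> : 1 - x ^+ 2 = (1 - x) * (1 + x) by ring.
  by field; rewrite x1' x1''.
split; first by apply: fh_scale; exact: fh_add.
move=> f Hf f_rot.
have f_rot' (b : C) z w : b ^+ (2 ^ n) = 1 -> val w = b *: val z -> f w = f z.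
  by move=> bN; apply: f_rot; rewrite expnS mulnC exprM bN expr1n.
rewrite fh_dotZr ?fh_dotDr //; last exact: fh_add.
rewrite dl // dal // (f_rot a l al) //; last first.
  by rewrite expnS mulnC exprM aN sqrrN expr1n.
by rewrite fmorphV /= rmorph_nat; field.
Qed.

(** For an invariant [f], the difference [f z - f 0] equals [<f, K_n(., z) - k_0>]
    for every [n], and [|K_n(., z) - k_0|^2 = a^(2^n) / (1 - a^(2^n))] with
    [a = |z|^2] tends to [0]. *)
Lemma rotation_invariant_const f : fh_carrier H f ->
  (forall (a : C) z w, `|a| = 1 -> val w = a *: val z -> f w = f z) ->
  forall z, f z = f o.
Proof.
move=> Hf f_rot z; have kP := da_reproducing H.
apply/eqP; rewrite -subr_eq0 -normr_eq0; apply/negP => /negP nz.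
have D0 : 0 < `|f z - f o| by rewrite lt_def nz normr_ge0.
pose a := cdot (val z) (val z).
have a0 : 0 <= a := cdot_ge0 _.
have a1 : a < 1 := valP z.
have a1' : 0 < 1 - a by rewrite subr_gt0.
(* For such an [n] the Cauchy-Schwarz bound on [<f, K_n(., z) - k_0>] falls below
   [|f z - f 0|]; the summand [1] keeps the divisor positive when [f = 0]. *)
have [n n_lt] : exists n, a ^+ (2 ^ n) <
    `|f z - f o| ^+ 2 * (1 - a) / (fh_norm H f ^+ 2 + 1).
  by apply: expr_pow2_lt; rewrite // !mulr_gt0 // invr_gt0 ltr_wpDl //
    exprn_ge0 ?fh_norm_ge0.
have N0 : (0 < 2 ^ n)%N by rewrite expn_gt0.
have root1 (b : C) : b ^+ (2 ^ n) = 1 -> `|b| = 1.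
  by move=> bN; apply/eqP; rewrite -(@pexpr_eq1 _ _ (2 ^ n)) // -normrX bN normr1.
have [HK K_dot] := rotation_average_kernelP n z.
set K := (rotation_average_kernel n)^~ z in HK K_dot.
have Ho := kernel_carrier kP o.
have HKo := fh_sub HK Ho.
have K_o : K o = 1.
  by rewrite /K /rotation_average_kernel cdot0l expr0n gtn_eqF // subr0 invr1.
have fD : fh_dot H f (K - k^~ o) = f z - f o.
  rewrite fh_dotBr // (kernel_dot kP) // K_dot // => b x y /root1; exact: f_rot.
have KD : fh_norm H (K - k^~ o) ^+ 2 = a ^+ (2 ^ n) / (1 - a ^+ (2 ^ n)).
  have K_rot (b : C) x y : b ^+ (2 ^ n) = 1 -> val y = b *: val x -> K y = K x.
    by move=> bN yx; rewrite /K /rotation_average_kernel yx cdotZl exprMn bN mul1r.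
  rewrite fh_norm_sqr fh_dotBl // !fh_dotBr // K_dot // !(kernel_dot kP) // K_o.
  rewrite (fh_dot_conj HK Ho) (kernel_dot kP) // K_o rmorph1 da_kernel_origin.
  rewrite subrr subr0 /K /rotation_average_kernel -/a.
  have aN : 1 - a ^+ (2 ^ n) != 0 by rewrite gt_eqF // subr_gt0 exprn_ilt1 // -lt0n.
  by field.
have := fh_cauchy_schwarz Hf HKo; rewrite fD.
apply/negP; rewrite -real_ltNge ?ger0_real ?mulr_ge0 ?fh_norm_ge0 //.
rewrite -(@ltr_pXn2r _ 2) ?nnegrE ?mulr_ge0 ?fh_norm_ge0 // exprMn KD.
move: n_lt; rewrite ltr_pdivlMr; last by rewrite ltr_wpDl // exprn_ge0 ?fh_norm_ge0.
have aN_a : a ^+ (2 ^ n) <= a by rewrite ler_iXnr // ltW.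
have aN0 : 0 <= a ^+ (2 ^ n) by rewrite exprn_ge0.
rewrite mulrA ltr_pdivrMr; last by rewrite subr_gt0 (le_lt_trans aN_a).
move=> n_lt; rewrite (@le_lt_trans _ _ (a ^+ (2 ^ n) * (fh_norm H f ^+ 2 + 1))) //.
  by rewrite mulrC ler_wpM2l // lerDl.
by rewrite (lt_le_trans n_lt) // ler_wpM2l ?exprn_ge0 // lerD2l lerN2.
Qed.

Lemma U_moebius_involution_origin l (l1 : cdot (val l) (val l) < 1) f :
  f l != 0 -> U_moebius H (moebius_involution l1) f o != 0.
Proof.
move=> fl; rewrite /U_moebius.
have -> : mb_ball_map (moebius_involution l1) o = l.
  by apply: val_inj; rewrite mb_ball_mapE moebius_involutionE ball_involution0.
rewrite mulf_neq0 // mulf_neq0 ?invr_eq0 ?fh_norm_kernel_neq0 //.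
by rewrite /da_kernel cdot0l subr0 oner_eq0.
Qed.

Lemma U_moebius_involution_kernel l (l1 : cdot (val l) (val l) < 1) :
  U_moebius H (moebius_involution l1) (k^~ o) =
  (fh_norm H (k^~ l))^-1 *: k^~ l.
Proof.
have inv0 : mb_inv0 (moebius_involution l1) = l.
  by apply: mb_inv0_unique; rewrite moebius_involutionE ball_involution_center.
apply/funext => z; rewrite /U_moebius inv0 da_kernel_origin mul1r mulrC.
by [].
Qed.

(** The rotated vector [p \o tau] represents evaluation at the origin as well: writing
    [g = (g \o sigma) \o tau] with the inverse rotation [sigma], unitarity
    gives [<g, p \o tau> = <g \o sigma, p> = g (sigma 0) = g 0].  Representing
    vectors in [M] are unique. *)
Lemma origin_representer_rotation (M : set (B -> C)) p :
    M `<=` fh_carrier H ->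
    (forall g h, M g -> M h -> M (g - h)) ->
    (forall (a : C) (a1 : `|a| = 1) g, M g ->
      M (g \o mb_ball_map (moebius_rotation d a1))) ->
    M p -> (forall g, M g -> fh_dot H g p = g o) ->
  forall (a : C) z w, `|a| = 1 -> val w = a *: val z -> p w = p z.
Proof.
move=> MH M_sub M_rot Mp p_dot a z w a1 wE.
have Hp := MH _ Mp; have kP := da_reproducing H.
have ca1 : `|Num.conj a| = 1 by rewrite norm_conjC.
pose tau := mb_ball_map (moebius_rotation d a1).
pose sigma := mb_ball_map (moebius_rotation d ca1).
have M_tau := M_rot _ a1.
have M_sigma := M_rot _ ca1.
have tauE x : val (tau x) = a *: val x by rewrite mb_ball_mapE.
have sigmaE x : val (sigma x) = Num.conj a *: val x by rewrite mb_ball_mapE.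
have sigmaK : cancel sigma tau.
  move=> x; apply: val_inj; rewrite /= tauE sigmaE scalerA -normCK a1.
  by rewrite expr1n scale1r.
have tauK : cancel tau sigma.
  move=> x; apply: val_inj; rewrite /= sigmaE tauE scalerA mulrC -normCK a1.
  by rewrite expr1n scale1r.
have k_tau x y : k (tau x) (tau y) = k x y.
  by rewrite /da_kernel !tauE cdot_unit_scale.
have Mpt := M_tau _ Mp; have Hpt := MH _ Mpt.
have pt_dot g : M g -> fh_dot H g (p \o tau) = g o.
  move=> Mg; have Mgs := M_sigma _ Mg.
  have gE : g = (g \o sigma) \o tau by apply/funext => x; rewrite /= tauK.
  rewrite {1}gE (fh_comp_dot kP sigmaK k_tau (MH _ Mgs) Hp) p_dot //=.
  by congr g; apply: val_inj; rewrite sigmaE /= scaler0.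
have -> : w = tau z by apply: val_inj; rewrite tauE.
have MD := M_sub _ _ Mpt Mp; have HD := MH _ MD.
have : fh_norm H (p \o tau - p) = 0.
  by apply/eqP; rewrite -sqrf_eq0 fh_norm_sqr fh_dotBr // p_dot // pt_dot // subrr.
by move=> /(fh_norm_eq0 HD)/subr0_eq/(congr1 (fun h => h z)).
Qed.

Lemma moebius_invariant_submodule_full (M : set (B -> C)) :
  closed_submodule H M ->
  (forall (phi : moebius R d) f, M f -> M (U_moebius H phi f)) ->
  (exists2 f, M f & f <> 0) -> forall f, fh_carrier H f -> M f.
Proof.
move=> Msub M_inv [f Mf f0].
have kP := da_reproducing H.
have MH := csm_sub Msub.
have M_lin (a : C) g h : M g -> M h -> M (a *: g + h).
  move=> Mg Mh; apply: (csm_add Msub _ Mh).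
  suff -> : a *: g = (fun z => mpoly.meval (fun i => val z 0 i) (mpoly.mpolyC d a) * g z).
    exact: (csm_poly Msub _ Mg).
  by apply/funext => z; rewrite mpoly.mevalC.
have M_sub g h : M g -> M h -> M (g - h).
  by move=> Mg Mh; rewrite addrC -scaleN1r; apply: M_lin.
have Ho := kernel_carrier kP o.
have [p [u [Hp Mu up p_orth]]] := fh_projection MH (csm_zero Msub) M_lin Ho.
have Mp : M p by exact: (csm_closed Msub Mu Hp up).
have p_dot g : M g -> fh_dot H g p = g o.
  move=> Mg; have Hg := MH _ Mg.
  have := p_orth _ Mg; rewrite fh_dotBl // => /eqP; rewrite subr_eq0 => /eqP E.
  by rewrite (fh_dot_conj Hp Hg) -E -(fh_dot_conj Ho Hg) (kernel_dot kP).
have M_rot (a : C) (a1 : `|a| = 1) g : M g ->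
    M (g \o mb_ball_map (moebius_rotation d a1)).
  by move=> Mg; rewrite -U_moebius_rotation; exact: M_inv.
have p_rot := origin_representer_rotation MH M_sub M_rot Mp p_dot.
have p_cst := rotation_invariant_const Hp p_rot.
(* Being constant, [p] would vanish with [p o], and then so would every [g o]. *)
have po0 : p o != 0.
  have [l fl] : exists l, f l != 0.
    apply: contrapT => nof; apply: f0; apply/funext => l.
    by apply/eqP; apply: contrapT => /negP fl; apply: nof; exists l.
  have := U_moebius_involution_origin (valP l) fl.
  set g := U_moebius H _ f => g0; have Mg : M g by exact: M_inv.
  have pE : p = p o *: k^~ o.
    by apply/funext => z; rewrite p_cst fctE da_kernel_origin [RHS]mulr1.
  apply: contraNneq g0 => po; rewrite -p_dot // pE po scale0r.
  by rewrite (fh_dot_conj (fh_zero H) (MH _ Mg)) fh_dot0l ?conjC0 //; exact: MH.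
have Mo : M (k^~ o).
  have -> : k^~ o = (p o)^-1 *: p + 0.
    apply/funext => z; rewrite addr0 fctE p_cst da_kernel_origin.
    by rewrite [RHS]mulVf.
  exact: M_lin Mp (csm_zero Msub).
have Mk l : M (k^~ l).
  have := M_inv (moebius_involution (valP l)) _ Mo.
  rewrite U_moebius_involution_kernel => /(M_lin (fh_norm H (k^~ l))).
  move=> /(_ _ (csm_zero Msub)); rewrite addr0 scalerA mulfV ?scale1r //.
  exact: fh_norm_kernel_neq0.
have Mspan g : kernel_span k g -> M g.
  elim=> [|a l h _ Mh]; first exact: csm_zero Msub.
  exact: M_lin.
move=> h Hh; have [v kv vh] := kernel_span_dense kP Hh.
by apply: (csm_closed Msub _ Hh vh) => n; exact: Mspan.
Qed.

End DruryArveson.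

Theorem theorem3p5 (R : realType) (d : nat) (H : drury_arveson R d)
    (M : set (ball_pt R d -> Cplx R)) :
  closed_submodule H M -> M <> [set 0] -> M <> H ->
  exists (xi : ball_pt R d -> Cplx R) (phi : moebius R d),
    M xi /\ ~ M (U_moebius H phi xi).
Proof.
move=> Msub M0 MH; apply: contrapT => no_witness; apply: MH.
apply/seteqP; split; first exact: csm_sub Msub.
apply: (moebius_invariant_submodule_full Msub) => [phi f Mf|].
  by apply: contrapT => nMf; apply: no_witness; exists f, phi.
apply: contrapT => no_f; apply: M0; apply/seteqP; split=> [f Mf|_ ->].
  by apply: contrapT => f0; apply: no_f; exists f.
exact: csm_zero Msub.
Qed.
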